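(* Let $n_1>\dots>n_k$ and $m_1>\dots>m_\ell$ be positive integers with $(n_1,\dots,n_k)\succ(m_1,\dots,m_\ell)$. If $F_{2n_1}F_{2n_2}\cdots F_{2n_k}=F_{2m_1}F_{2m_2}\cdots F_{2m_\ell}$, then $k=\ell$ and $m_i=n_i$ for all $i$.
   Context: $F_n$ is the Fibonacci sequence with $F_0=1$, $F_1=1$, $F_{n+2}=F_{n+1}+F_n$ for $n\ge0$. Majorization: for finite non-increasing sequences of positive integers $(a_1,\dots,a_n)$ and $(b_1,\dots,b_k)$, write $(a_1,\dots,a_n)\succ(b_1,\dots,b_k)$ if: (1) $n\le k$; (2) for every $i\le n$, $a_1+\dots+a_i\ge b_1+\dots+b_i$; (3) $a_1+\dots+a_n\ge b_1+\dots+b_k$. *)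

(* Defs.v *)
From mathcomp Require Import all_boot.
Set Implicit Arguments. Unset Strict Implicit. Unset Printing Implicit Defensive.

(* Shifted indexing: F_0 = F_1 = 1, whereas the usual convention has F_0 = 0. *)
Fixpoint fibF (n : nat) : nat :=
  if n is n'.+1 then
    if n' is n''.+1 then fibF n' + fibF n'' else 1
  else 1.

(* Intended for non-increasing sequences of positive integers.  By the first
   condition, i <= size b as well in the second, so that [take i b] has
   exactly i terms. *)
Definition majorizes (a b : seq nat) : Prop :=
  [/\ size a <= size b,
      forall i, i <= size a -> sumn (take i b) <= sumn (take i a)
    & sumn b <= sumn a].

(* Main.v *)
Require Import Defs.
From mathcomp Require Import all_boot.
From mathcomp Require Import order ssralg ssrnum realalg zify ring lra.
Import Order.TTheory GRing.Theory Num.Theory.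

(**
  Let [h = (3 - sqrt 5) / 2], the root of [h^2 = 3 h - 1] in [(0, 1/2)].  Then
  [(1 + h) h^n F_(2n) = 1 + h^(2n+1)], so that, writing [W s] for the product of
  the [1 + h^(2n+1)] with [n] in [s] and [P] for the common value of the two
  products, [W ns = P (1 + h)^k h^(sum ns)], and similarly for [ms].
  Dividing, [W ms h^d = W ns (1 + h)^e], where [d = sum ns - sum ms >= 0] and
  [e = l - k >= 0].  As the factors of [W] tend to 1 very fast,
  [1 <= W <= 1 + h^2] on sets of positive integers; this forces [d = e = 0].
  Finally [W] determines its argument, since
  [1 + h^(2p+1) > 1 + h^(2p+2) >= W s] whenever all elements of [s] exceed [p].
*)

Local Open Scope ring_scope.

Lemma fibF_even_rec (n : nat) :
  (fibF (2 * n.+2) + fibF (2 * n) = 3 * fibF (2 * n.+1))%N.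
Proof.
rewrite !mulnS !addSn !add0n.
have step k : fibF k.+2 = (fibF k.+1 + fibF k)%N by [].
by rewrite !step; lia.
Qed.

(** Binet's formula cleared of denominators: [h] and its inverse are the roots of [x^2 = 3 x - 1],
    the characteristic equation of [fibF_even_rec]. *)
Lemma fibF_even_closed (R : realFieldType) (h : R) (n : nat) :
  h ^+ 2 = 3 * h - 1 ->
  (fibF (2 * n))%:R * ((1 + h) * h ^+ n) = 1 + h ^+ n.*2.+1.
Proof.
move=> hE; suff [] : (fibF (2 * n))%:R * ((1 + h) * h ^+ n) = 1 + h ^+ n.*2.+1 /\
  (fibF (2 * n.+1))%:R * ((1 + h) * h ^+ n.+1) = 1 + h ^+ n.+1.*2.+1 by [].
elim: n => [|n [IH0 IH1]]; split=> //.
- by rewrite muln0 expr0 expr1 mul1r mulr1.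
- have -> : fibF (2 * 1) = 2%N by [].
  by rewrite -[1.*2.+1]/3%N; ring: hE.
have /(congr1 (fun m => m%:R : R)) := fibF_even_rec n.
rewrite natrD natrM => /(canRL (addrK _)) ->.
have -> : (3 * (fibF (2 * n.+1))%:R - (fibF (2 * n))%:R) *
    ((1 + h) * h ^+ n.+2) =
  3 * h * ((fibF (2 * n.+1))%:R * ((1 + h) * h ^+ n.+1)) -
  h ^+ 2 * ((fibF (2 * n))%:R * ((1 + h) * h ^+ n)).
  by rewrite !exprS; ring.
rewrite IH0 IH1 !doubleS !exprS; move: (h ^+ n.*2) => y.
by ring: hE.
Qed.

Section CorrectionProduct.

Variables (R : realFieldType) (h : R).
Hypotheses (h_gt0 : 0 < h) (h_lt : 2 * h < 1).

Definition corr_prod (s : seq nat) : R := \prod_(n <- s) (1 + h ^+ n.*2.+1).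

Lemma prod_fibF_even (s : seq nat) : h ^+ 2 = 3 * h - 1 ->
  (\prod_(n <- s) fibF (2 * n))%:R * ((1 + h) ^+ size s * h ^+ sumn s) =
  corr_prod s.
Proof.
move=> hE; rewrite /corr_prod; elim: s => [|n s IH] /=.
  by rewrite !big_nil !expr0 !mulr1.
rewrite !big_cons -IH -(fibF_even_closed _ _ n hE) natrM exprS exprD.
by ring.
Qed.

Lemma corr_prod_ge1 (s : seq nat) : 1 <= corr_prod s.
Proof.
rewrite /corr_prod; elim: s => [|n s IH]; first by rewrite big_nil.
by rewrite big_cons mulr_ege1 // lerDl exprn_ge0 // ltW.
Qed.

(** The bound is shaped so that induction closes: for a head [n] and [y = h^(2n)], the tail
    contributes at most [1 + h^2 y], and [(1 + h y)(1 + h^2 y) <= 1 + y] because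
    [h + h^2 + h^3 y <= 1/2 + 1/4 + 1/4]. *)
Lemma corr_prod_le (s : seq nat) (p : nat) :
  sorted ltn s -> {in s, forall x, (p <= x)%N} ->
  corr_prod s <= 1 + h ^+ p.*2.
Proof.
have [h_pos h_half] := (h_gt0, h_lt); have h_le1 : h <= 1 by lra.
rewrite /corr_prod; elim: s p => [|n s IH] p /=.
  by move=> _ _; rewrite big_nil lerDl exprn_ge0 // ltW.
rewrite path_sortedE; last exact: ltn_trans.
move=> /andP[/allP n_lt s_sorted] p_le.
have {}IH := IH n.+1 s_sorted n_lt; rewrite big_cons.
have pn : h ^+ n.*2 <= h ^+ p.*2.
  rewrite ler_wiXn2l ?(ltW h_gt0) // leq_double.
  by rewrite p_le ?mem_head.
have y_gt0 : 0 < h ^+ n.*2 by rewrite exprn_gt0.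
have y_le1 : h ^+ n.*2 <= 1 by rewrite exprn_ile1 // ltW.
apply: le_trans (_ : 1 + h ^+ n.*2 <= _); last by rewrite lerD2l.
move: IH; rewrite doubleS !exprS; set y := h ^+ n.*2 in y_gt0 y_le1 *.
move=> IH; apply: le_trans (_ : (1 + h * y) * (1 + h * (h * y)) <= _).
  by apply: ler_wpM2l IH; rewrite addr_ge0 // mulr_ge0 // ltW.
have hh : h * h <= 1 / 4 by nra.
have hhh : h * (h * h) * y <= 1 / 4.
  have : h * (h * h) <= 1 / 4 by nra.
  have : 0 <= h * (h * h) by rewrite !mulr_ge0 // ltW.
  by nra.
have : y * (h + h * h + h * (h * h) * y) <= y * 1 by rewrite ler_pM2l //; lra.
by lra.
Qed.

Lemma corr_prod_lt_head (p : nat) (s t : seq nat) :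
  sorted ltn t -> {in t, forall x, (p < x)%N} ->
  corr_prod t < corr_prod (p :: s).
Proof.
move=> t_sorted p_lt; apply: le_lt_trans (corr_prod_le _ _ t_sorted p_lt) _.
rewrite /corr_prod big_cons -/(corr_prod s) doubleS [h ^+ _.+2]exprS.
have := corr_prod_ge1 s.
have : 0 < h ^+ p.*2.+1 by rewrite exprn_gt0.
by have [h_pos h_half] := (h_gt0, h_lt); nra.
Qed.

(** If the least elements differ, the list with the smaller one has the strictly larger product; if
    they agree, their common factor cancels. *)
Lemma corr_prod_inj (s t : seq nat) :
  sorted ltn s -> sorted ltn t -> corr_prod s = corr_prod t -> s = t.
Proof.
elim: s t => [|x s IH] [|y t] // s_sorted t_sorted eq_st.
- by have := corr_prod_lt_head y t [::] isT (fun _ => ltac:(by [])); rewrite eq_st ltxx.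
- by have := corr_prod_lt_head x s [::] isT (fun _ => ltac:(by [])); rewrite eq_st ltxx.
have above z r w : path ltn z r -> (w < z)%N -> {in z :: r, forall x, (w < x)%N}.
  move=> /(order_path_min ltn_trans)/allP z_lt wz v.
  by rewrite inE => /predU1P[->|/z_lt/(ltn_trans wz)].
have [xy|yx|eq_xy] := ltngtP x y.
- by have := corr_prod_lt_head _ s _ t_sorted (above _ _ _ t_sorted xy); rewrite eq_st ltxx.
- by have := corr_prod_lt_head _ t _ s_sorted (above _ _ _ s_sorted yx); rewrite eq_st ltxx.
rewrite eq_xy (IH t) ?(path_sorted s_sorted) ?(path_sorted t_sorted) //.
apply: (@mulfI _ (1 + h ^+ y.*2.+1)).
  by rewrite gt_eqF // addr_gt0 // exprn_gt0.
by move: eq_st; rewrite /corr_prod !big_cons eq_xy.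
Qed.

(* Cross-multiplied form of the comparison of [prod_fibF_even] for two lists. *)
Lemma corr_prod_exponents (s t : seq nat) (d e : nat) :
  sorted ltn t -> {in t, forall x, (0 < x)%N} ->
  corr_prod t * h ^+ d = corr_prod s * (1 + h) ^+ e -> d = 0%N /\ e = 0%N.
Proof.
move=> t_sorted t_pos E.
(* [0 < x] unfolds to [1 <= x], so this is the case [p = 1], with bound [1 + h^2]. *)
have := corr_prod_le _ _ t_sorted t_pos; rewrite expr2 => t_le.
have [s_ge1 t_ge1] := (corr_prod_ge1 s, corr_prod_ge1 t).
have [h_pos h_half] := (h_gt0, h_lt); have h_le1 : h <= 1 by lra.
have hd0 : 0 <= h ^+ d by rewrite exprn_ge0 // ltW.
have hd1 : h ^+ d <= 1 by rewrite exprn_ile1 // ltW.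
have he1 : 1 <= (1 + h) ^+ e by rewrite exprn_ege1 // lerDl ltW.
have hh : h * h < h by nra.
have lhs_le : corr_prod t * h ^+ d <= corr_prod t by nra.
have rhs_ge : (1 + h) ^+ e <= corr_prod s * (1 + h) ^+ e by nra.
(* If [d > 0], the left side of [E] is at most [(1 + h^2) h < 1]; if [e > 0], the right side is at
   least [1 + h > 1 + h^2]. *)
split; apply/eqP; rewrite -leqn0 leqNgt; apply/negP => pos.
- have : h ^+ d <= h by rewrite -[leRHS]expr1 ler_wiXn2l // ltW.
  by nra.
- have : 1 + h <= (1 + h) ^+ e by rewrite -[leLHS]expr1 ler_weXn2l // lerDl ltW.
  by lra.
Qed.

End CorrectionProduct.

Lemma exists_fib_root (R : rcfType) :
  exists h : R, [/\ h ^+ 2 = 3 * h - 1, 0 < h & 2 * h < 1].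
Proof.
have sq : Num.sqrt (5 : R) ^+ 2 = 5 by rewrite sqr_sqrtr.
have r0 : 0 <= Num.sqrt (5 : R) by rewrite sqrtr_ge0.
exists ((3 - Num.sqrt 5) / 2); move: (Num.sqrt 5) sq r0 => r; rewrite !expr2.
(* With [h = (3 - r) / 2], [2 < r] gives [2 h < 1] and [r < 3] gives [0 < h]. *)
move=> sq r0; have r_gt2 : 2 < r by nra.
have r_lt3 : r < 3 by nra.
by split; nra.
Qed.

Local Close Scope ring_scope.

Theorem theorem3p5 (ns ms : seq nat)
    (ns_decr : sorted gtn ns) (ms_decr : sorted gtn ms)
    (ns_pos : forall x, x \in ns -> 0 < x)
    (ms_pos : forall x, x \in ms -> 0 < x)
    (ns_maj_ms : majorizes ns ms)
    (prod_eq : \prod_(n <- ns) fibF (2 * n) = \prod_(m <- ms) fibF (2 * m)) :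
  size ns = size ms /\ (forall i, i < size ns -> nth 0 ms i = nth 0 ns i).
Proof.
suff -> : ns = ms by [].
have [h [hE h_gt0 h_lt]] := exists_fib_root realalg.
have [size_le _ sum_le] := ns_maj_ms.
(* The estimates peel off the least element first, so the decreasing lists are reversed. *)
have corr_rev s : corr_prod _ h (rev s) = corr_prod _ h s.
  by apply: perm_big; rewrite perm_rev.
have rns : sorted ltn (rev ns) by rewrite rev_sorted.
have rms : sorted ltn (rev ms) by rewrite rev_sorted.
have rms_pos : {in rev ms, forall x, 0 < x} by move=> x; rewrite mem_rev; exact: ms_pos.
have En := prod_fibF_even _ h ns hE; have Em := prod_fibF_even _ h ms hE.
(* By [sum_le] and [size_le], neither natural subtraction truncates. *)
have E : (corr_prod _ h (rev ms) * h ^+ (sumn ns - sumn ms) =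
          corr_prod _ h (rev ns) * (1 + h) ^+ (size ms - size ns))%R.
  rewrite !corr_rev -En -Em prod_eq -{2}(subnKC sum_le) -{1}(subnKC size_le).
  by rewrite !exprD; ring.
have [d0 e0] := corr_prod_exponents _ _ h_gt0 h_lt _ _ _ _ rms rms_pos E.
apply: (can_inj revK).
apply: (corr_prod_inj _ _ h_gt0 h_lt _ _ rns rms).
by move: E; rewrite d0 e0 !expr0 !mulr1 => ->.
Qed.
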